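(* Let $X\in\mathbb R^{n\times p}$ be a fixed feature matrix and $y\in\mathbb R^n$ the response. Consider either the saturated model $M_{sat}=\{N(\mu,\sigma^2I):\mu\in\mathbb R^n\}$ with parameter $\theta=\mu$, or the selected model $M_{sel}(E)=\{N(X_E\beta_E,\sigma^2I):\beta_E\in\mathbb R^{|E|}\}$, $E\subset\{1,\dots,p\}$, with parameter $\theta=\beta_E$. Suppose Gaussian randomization noise $\omega\sim\mathbb Q=N(0,\gamma^2I)$, independent of $y$, is used and the selection is based on $\widehat{\mathcal Q}(y^* )=\widehat{\mathcal Q}(y+\omega)$. Then the leftover Fisher information is bounded below (in the positive semidefinite order) by $$(1-\tau)\,\mathcal I(\theta),\qquad \tau=\frac{\sigma^2}{\sigma^2+\gamma^2},$$ where $\mathcal I(\theta)$ is the non-selective Fisher information for $\theta$ in $M_{sat}$ or $M_{sel}(E)$ respectively.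
   Context: $X_E$ denotes the submatrix of columns of $X$ indexed by $E$. $\widehat{\mathcal Q}$ is a selection algorithm, a (measurable) set-valued function of the randomized response $y^*=y+\omega$. The selective distribution is the law of $y$ given the selection outcome, determined by $\widehat{\mathcal Q}(y^* )$. The score statistic is $V=(y-\mu)/\sigma^2$ in $M_{sat}$ and $V=X_E^T(y-X_E\beta_E)/\sigma^2$ in $M_{sel}(E)$. The leftover Fisher information is the covariance matrix of the score statistic $V$ under the selective distribution, i.e. $\mathrm{Var}[V\mid\widehat{\mathcal Q}(y^* )]$. The non-selective informations are $\mathcal I(\mu)=\sigma^{-2}I$ and $\mathcal I(\beta_E)=\sigma^{-2}X_E^TX_E$. *)

(* Defs.v *)
From HB Require Import structures.
From mathcomp Require Import all_boot all_order all_algebra.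
From mathcomp Require Import all_classical all_reals all_analysis.

Set Implicit Arguments.
Unset Strict Implicit.
Unset Printing Implicit Defensive.

Import Order.TTheory GRing.Theory Num.Theory.
Import numFieldNormedType.Exports.

Local Open Scope classical_set_scope.
Local Open Scope ring_scope.

(* The sigma-algebra on R^n generated by the coordinates, i.e. the Borel one. *)
Section measurable_cV.
Context {R : realType}.
Variable n : nat.

Let coord : 'I_n -> 'cV[R]_n -> R := fun i x => x i 0.

Let cV_set0 : g_sigma_preimage coord set0.
Proof. exact: sigma_algebra0. Qed.

Let cV_setC A : g_sigma_preimage coord A -> g_sigma_preimage coord (~` A).
Proof. exact: sigma_algebraC. Qed.

Let cV_bigcup (F : _^nat) : (forall i, g_sigma_preimage coord (F i)) ->
  g_sigma_preimage coord (\bigcup_i (F i)).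
Proof. exact: sigma_algebra_bigcup. Qed.

HB.instance Definition _ := @isMeasurable.Build default_measure_display
  'cV[R]_n (g_sigma_preimage coord) cV_set0 cV_setC cV_bigcup.

End measurable_cV.

(* [mu] is N(m, s^2 I), that is, the product of the N(m_i, s^2); [s] is the
   standard deviation, as in [normal_prob]. *)
Definition isotropic_normal (R : realType) (n : nat) (m : 'cV[R]_n) (s : R)
    (mu : set 'cV[R]_n -> \bar R) : Prop :=
  forall B : 'I_n -> set R, (forall i, measurable (B i)) ->
    mu [set x | forall i, B i (x i 0)] =
    (\prod_(i < n) normal_prob (m i 0%R) s (B i))%E.

Definition independent_RV d d1 d2 (T : measurableType d)
    (T1 : measurableType d1) (T2 : measurableType d2) (R : realType)
    (P : probability T R) (Y : {RV P >-> T1}) (W : {RV P >-> T2}) : Prop :=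
  forall A B, measurable A -> measurable B ->
    P (Y @^-1` A `&` W @^-1` B) = (P (Y @^-1` A) * P (W @^-1` B))%E.

(* [K] is a regular conditional distribution of [Y] given [Q]: [K q] is the law
   of [Y] given the outcome [Q = q]. *)
Definition selective_distribution d d1 d2 (T : measurableType d)
    (T1 : measurableType d1) (S : measurableType d2) (R : realType)
    (P : probability T R) (Y : {RV P >-> T1}) (Q : T -> S)
    (K : {mfun S >-> pprobability T1 R}) : Prop :=
  forall A B, measurable A -> measurable B ->
    P (Q @^-1` A `&` Y @^-1` B) =
    (\int[P]_(t in Q @^-1` A) (K (Q t) : probability T1 R) B)%E.

(* [fine] is harmless on the selective distributions of a Gaussian vector: the
   second moments of these are almost surely finite. *)
Definition covariance_mx d (T : measurableType d) (R : realType) (k : nat)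
    (mu : probability T R) (V : T -> 'cV[R]_k) : 'M[R]_k :=
  \matrix_(i, j)
    fine (covariance mu (fun x => V x i 0) (fun x => V x j 0)).

Definition psdmx (R : realType) (k : nat) (A : 'M[R]_k) : Prop :=
  A^T = A /\ forall u : 'cV[R]_k, 0 <= (u^T *m A *m u) 0 0.

Definition loewner_le (R : realType) (k : nat) (A B : 'M[R]_k) : Prop :=
  psdmx (B - A).

Definition submx_cols (R : realType) (n p : nat) (X : 'M[R]_(n, p))
    (E : {set 'I_p}) : 'M[R]_(n, #|E|) :=
  colsub (fun k : 'I_#|E| => enum_val k) X.

Definition score_sat (R : realType) (n : nat) (sigma : R) (mu y : 'cV[R]_n) :
    'cV[R]_n :=
  sigma ^- 2 *: (y - mu).

Definition fisher_sat (R : realType) (n : nat) (sigma : R) : 'M[R]_n :=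
  sigma ^- 2 *: 1%:M.

Definition score_sel (R : realType) (n p : nat) (X : 'M[R]_(n, p))
    (E : {set 'I_p}) (sigma : R) (beta : 'cV[R]_#|E|) (y : 'cV[R]_n) :
    'cV[R]_#|E| :=
  sigma ^- 2 *: ((submx_cols X E)^T *m (y - submx_cols X E *m beta)).

Definition fisher_sel (R : realType) (n p : nat) (X : 'M[R]_(n, p))
    (E : {set 'I_p}) (sigma : R) : 'M[R]_#|E| :=
  sigma ^- 2 *: ((submx_cols X E)^T *m submx_cols X E).

(* The covariance matrix of the score [V] under the selective distribution
   attached to the selection outcome [q]. *)
Definition leftover_fisher (R : realType) (n k : nat) d (S : measurableType d)
    (K : {mfun S >-> pprobability 'cV[R]_n R}) (V : 'cV[R]_n -> 'cV[R]_k)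
    (q : S) : 'M[R]_k :=
  covariance_mx (K q : probability 'cV[R]_n R) V.

(* Main.v *)
Require Import Defs.
From HB Require Import structures.
From mathcomp Require Import all_boot all_order all_algebra.
From mathcomp Require Import all_classical all_reals all_analysis.
From mathcomp Require Import measurable_realfun.
From mathcomp Require Import ring lra.

Set Implicit Arguments.
Unset Strict Implicit.
Unset Printing Implicit Defensive.

Import Order.TTheory GRing.Theory Num.Theory.
Import numFieldNormedType.Exports.

Local Open Scope classical_set_scope.
Local Open Scope ring_scope.

(** Put [tau = sigma^2 / (sigma^2 + gamma^2)] and let [y* = y + omega] be the
randomized response. The vector [e = (y - m) - tau (y* - m)] is normal with
covariance [(1 - tau) sigma^2 I] and is independent of [y*]: it is the part of
[y] that no selection rule based on [y*] can see. Since
[y - m = tau (y* - m) + e], conditioning on a function of [y*] leaves at least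
the variance of [e] in every direction.

The independence is a planar fact about two normal densities
([normal_pdf_mul], [normal_rotation]); it is transported to vectors one pair of
coordinates at a time ([joint_law_of_rectangles], [gaussian_decomposition]).

The lower bound on the conditional variance avoids conditional expectations.
For a direction [a] and a constant [c], the integral of
[(c + a . (y - m))^2] over an event [Q in A] is at least
[(1 - tau) sigma^2 |a|^2 P(Q in A)], because integrating out [e] first gives a
square plus the variance of [a . e] ([integral_sqr_add_noise_ge]). Rewriting
the left-hand side through the selective laws ([ge0_integral_selective]) and
letting [A] vary, the second moment of [c + a . (x - m)] under the selective
law is almost surely at least [(1 - tau) sigma^2 |a|^2]
([ae_quadratic_bound]). This holds simultaneously for all rational [(a, c)],
hence for all real ones by density ([quadratic_bound_dense]). The random
choice of [c] that centers [a . x] under the selective law then turns the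
second moment into a variance ([covariance_mx_quadratic]). Both scores are of
the form [sigma^-2 A^T (y - m)], with [A] the identity or the selected columns,
so a bound for a general matrix [A] covers the two models
([leftover_lower_bound]). *)

(** * Integrals against mixtures and densities *)

Section mixture.
Local Open Scope ereal_scope.
Context d d' (X : measurableType d) (Y : measurableType d') (R : realType).
Variables (mu : {measure set X -> \bar R}) (D : set X) (mD : measurable D).
Variables (kap : X -> {measure set Y -> \bar R}).
Variables (nu : {measure set Y -> \bar R}).
Hypothesis mkap : forall B, measurable B -> measurable_fun [set: X] (kap ^~ B).
Hypothesis nuE : forall B, measurable B -> nu B = \int[mu]_(x in D) kap x B.

Import HBNNSimple.

Let nnsfun_integral_mixture (h : {nnsfun Y >-> R}) :
  \int[nu]_y (h y)%:E = \int[mu]_(x in D) \int[kap x]_y (h y)%:E.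
Proof.
rewrite integralT_nnsfun sintegralE.
under [RHS]eq_integral do rewrite integralT_nnsfun sintegralE.
rewrite ge0_integral_fsum//.
- apply: eq_fsbigr => r _; rewrite nuE//.
  have [r0|r0] := leP 0%R r.
    rewrite ge0_integralZl//.
    exact/measurable_funTS/mkap.
  rewrite preimage_nnfun0// integral0_eq ?mule0.
    by rewrite integral0_eq// => x _; rewrite measure0 mule0.
  by move=> x _; rewrite measure0.
- by move=> r; apply: measurable_funeM; exact/measurable_funTS/mkap.
- move=> r x _; have [r0|r0] := leP 0%R r; first by rewrite mule_ge0.
  by rewrite preimage_nnfun0// measure0 mule0.
Qed.

(** Densities and regular conditional distributions are both mixtures: of point
masses for the former, of the conditional laws for the latter. *)
Lemma ge0_integral_mixture (f : Y -> \bar R) :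
  measurable_fun [set: Y] f -> (forall y, 0 <= f y) ->
  \int[nu]_y f y = \int[mu]_(x in D) \int[kap x]_y f y.
Proof.
move=> mf f0; pose g := nnsfun_approx measurableT mf.
have glim (m : {measure set Y -> \bar R}) :
    \int[m]_y f y = limn (fun n => \int[m]_y (g n y)%:E).
  transitivity (\int[m]_y (limn (fun n => (g n y)%:E))).
    apply: eq_integral => y _; apply/esym/cvg_lim => //.
    exact: cvg_nnsfun_approx.
  rewrite monotone_convergence//.
  - by move=> n; exact/measurable_EFinP.
  - by move=> n y _; rewrite lee_fin.
  - by move=> y _ a b ab; rewrite lee_fin; exact/lefP/nd_nnsfun_approx.
rewrite glim; under eq_fun do rewrite nnsfun_integral_mixture.
under [RHS]eq_integral do rewrite glim.
rewrite monotone_convergence//.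
- move=> n; apply: measurable_funTS.
  apply: measurable_fun_integral_kernel => //.
  + by move=> y; rewrite lee_fin.
  + exact/measurable_EFinP.
- by move=> n x _; apply: integral_ge0 => y _; rewrite lee_fin.
- move=> x _ a b ab; apply: ge0_le_integral => //.
  + by move=> y _; rewrite lee_fin.
  + exact/measurable_EFinP.
  + exact/measurable_EFinP.
  + by move=> y _; rewrite lee_fin; exact/lefP/nd_nnsfun_approx.
Qed.

End mixture.

Lemma ge0_integral_density d (X : measurableType d) (R : realType)
    (mu nu : {measure set X -> \bar R}) (p : X -> R) (f : X -> \bar R) :
  measurable_fun [set: X] p -> (forall x, 0 <= p x) ->
  (forall A, measurable A -> nu A = \int[mu]_(x in A) (p x)%:E)%E ->
  measurable_fun [set: X] f -> (forall x, 0 <= f x)%E ->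
  (\int[nu]_x f x = \int[mu]_x ((p x)%:E * f x))%E.
Proof.
move=> mp p0 nuE mf f0.
pose kap x : {measure set X -> \bar R} := mscale (NngNum (p0 x)) (dirac x).
rewrite (@ge0_integral_mixture _ _ X X _ mu setT measurableT kap)//.
- apply: eq_integral => x _.
  by rewrite ge0_integral_mscale// integral_dirac// diracT mul1e.
- move=> B mB; apply: emeasurable_funM => //; first exact/measurable_EFinP.
  exact: measurable_fun_dirac.
- move=> B mB; rewrite nuE// integral_mkcond; apply: eq_integral => x _.
  rewrite /kap/= /mscale/= diracE patchE.
  by case: ifPn => _; rewrite ?mule1 ?mule0.
Qed.

(** * One-dimensional normal laws *)

Section normal_density.
Variable R : realType.
Local Notation mu := lebesgue_measure.

Lemma lebesgue_measure_shift (c : R) (A : set R) : measurable A ->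
  pushforward mu (fun x : measurableTypeR R => x + c : measurableTypeR R) A
  = mu A.
Proof.
move=> mA; apply/esym/lebesgue_measure_unique => //=.
  exact: measurable_funD.
move=> mf _ [[a b]] _ <-.
rewrite /pushforward.
rewrite [X in _ = mu X](_ : _ = `]a - c, b - c]%classic); last first.
  by apply/seteqP; split => x /=; rewrite !in_itv/= ?ltrBlDr ?lerBrDr.
rewrite !lebesgue_measure_itv/= !lte_fin ltrD2r -!EFinD; case: ifP => // _.
by congr EFin; ring.
Qed.

Lemma ge0_integral_shift (c : R) (f : R -> \bar R) :
  measurable_fun [set: R] f -> (forall x, 0 <= f x)%E ->
  (\int[mu]_x f (x + c)%R = \int[mu]_x f x)%E.
Proof.
move=> mf f0.
pose shiftc (x : measurableTypeR R) : measurableTypeR R := x + c.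
have ms : measurable_fun setT shiftc by exact: measurable_funD.
transitivity (\int[pushforward mu shiftc]_x f x)%E.
  by rewrite ge0_integral_pushforward.
by apply: eq_measure_integral => A mA _; exact: lebesgue_measure_shift.
Qed.

Lemma ge0_integral_normal (m s : R) (f : R -> \bar R) :
  measurable_fun [set: R] f -> (forall x, 0 <= f x)%E ->
  (\int[normal_prob m s]_x f x = \int[mu]_x ((normal_pdf m s x)%:E * f x))%E.
Proof.
move=> mf f0; apply: ge0_integral_density => //.
- exact: measurable_normal_pdf.
- exact: normal_pdf_ge0.
Qed.

(** Completing the square: with [u] the signal and [z - u] the noise, the joint
density factors into that of the sum [z] and that of the residual
[u - tau * z]. *)
Lemma normal_pdf_mul (sigma gamma u z : R) : 0 < sigma -> 0 < gamma ->
  let S := Num.sqrt (sigma ^+ 2 + gamma ^+ 2) in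
  let tau := sigma ^+ 2 / (sigma ^+ 2 + gamma ^+ 2) in
  normal_pdf 0 sigma u * normal_pdf 0 gamma (z - u) =
  normal_pdf 0 S z * normal_pdf 0 (sigma * gamma / S) (u - tau * z).
Proof.
move=> s0 g0 S tau.
have v0 : 0 < sigma ^+ 2 + gamma ^+ 2 by rewrite addr_gt0 ?exprn_gt0.
have S2 : S ^+ 2 = sigma ^+ 2 + gamma ^+ 2 by rewrite sqr_sqrtr// ltW.
have S0 : 0 < S by rewrite sqrtr_gt0.
have ss0 : 0 < sigma * gamma / S by rewrite divr_gt0 ?mulr_gt0.
rewrite !normal_pdfE ?gt_eqF//.
rewrite mulrACA [RHS]mulrACA; congr (_ * _).
  rewrite /normal_peak -!invfM -!sqrtrM; last 2 first.
  - by rewrite mulrn_wge0// mulr_ge0 ?pi_ge0 ?sqr_ge0.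
  - by rewrite mulrn_wge0// mulr_ge0 ?pi_ge0 ?sqr_ge0.
  by congr (_^-1); congr Num.sqrt; field; rewrite gt_eqF.
rewrite /normal_fun -!expRD; congr expR.
rewrite !subr0 expr_div_n S2 /tau.
by field; rewrite ?gt_eqF.
Qed.
End normal_density.

Section normal_plane.
Variable R : realType.
Local Notation mu := lebesgue_measure.

Lemma normal_probE (m s : R) (B : set R) : measurable B ->
  normal_prob m s B = (\int[mu]_x ((normal_pdf m s x)%:E * (\1_B x)%:E))%E.
Proof.
move=> mB; rewrite -ge0_integral_normal//.
  by rewrite integral_indic// setIT.
exact/measurable_EFinP.
Qed.

Lemma measurable_pdf_indic (m s : R) (B : set R) : measurable B ->
  measurable_fun [set: R] (fun x => (normal_pdf m s x)%:E * (\1_B x)%:E)%E.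
Proof.
move=> mB; apply: emeasurable_funM; apply/measurable_EFinP => //.
exact: measurable_normal_pdf.
Qed.

Lemma pdf_indic_ge0 (m s : R) (B : set R) x :
  (0 <= (normal_pdf m s x)%:E * (\1_B x)%:E)%E.
Proof. by rewrite mule_ge0// lee_fin normal_pdf_ge0. Qed.

(** [s = 0] is excluded because [normal_pdf m 0] is the uniform density on the
unit interval, whatever [m]. *)
Lemma normal_prob_center (m s : R) (B : set R) : s != 0 -> measurable B ->
  normal_prob m s ((fun x => x - m) @^-1` B) = normal_prob 0 s B.
Proof.
move=> s0 mB; rewrite !normal_probE//; last first.
  rewrite -[X in measurable X]setTI.
  have mf : measurable_fun [set: R] (fun x : R => x - m).
    exact: measurable_funB.
  exact: mf.
rewrite -[RHS](@ge0_integral_shift _ (- m)).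
- apply: eq_integral => x _; rewrite normal_pdfE// [in RHS]normal_pdfE//.
  by rewrite normal_fun_center.
- exact: measurable_pdf_indic.
- by move=> x; exact: pdf_indic_ge0.
Qed.

Lemma normal_prob_opp (s : R) (B : set R) : s != 0 -> measurable B ->
  normal_prob 0 s (-%R @^-1` B) = normal_prob 0 s B.
Proof.
move=> s0 mB; rewrite /normal_prob.
pose opp : measurableTypeR R -> measurableTypeR R := -%R.
have mopp : measurable_fun setT opp by exact: oppr_measurable.
transitivity (\int[pushforward mu opp]_(x in B) (normal_pdf 0 s x)%:E)%E.
  rewrite [RHS]ge0_integral_pushforward//.
  - apply: eq_integral => x _ /=; congr EFin.
    by rewrite !normal_pdfE// /normal_fun !subr0 sqrrN.
  - apply/measurable_EFinP/measurable_funTS; exact: measurable_normal_pdf.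
  - by move=> x _; rewrite lee_fin normal_pdf_ge0.
by apply: eq_measure_integral => A mA _; exact: lebesgue_measureN.
Qed.

Lemma measurable_rotation (tau : R) (A B : set R) :
  measurable A -> measurable B ->
  measurable
    [set p : R * R | A (p.1 + p.2)%R /\ B (p.1 - tau * (p.1 + p.2))%R].
Proof.
move=> mA mB.
have mp1 : measurable_fun setT (fun p : R * R => p.1 + p.2)%R.
  exact: measurable_funD.
have mp2 : measurable_fun setT (fun p : R * R => p.1 - tau * (p.1 + p.2))%R.
  by apply: measurable_funB => //; exact: measurable_funM.
rewrite (_ : mkset _ = (fun p : R * R => p.1 + p.2)%R @^-1` A `&`
  (fun p : R * R => p.1 - tau * (p.1 + p.2))%R @^-1` B); last by [].
apply: measurableI; rewrite -[X in measurable X]setTI.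
- exact: (mp1 measurableT A mA).
- exact: (mp2 measurableT B mB).
Qed.

(** The independence of [y*] and [e] in dimension one. After the change of
variables [z = u + w] the density no longer couples [z] and [u - tau * z], and
the inner integral in [u] is translation invariant. *)
Lemma normal_rotation (sigma gamma : R) (A B : set R) :
  0 < sigma -> 0 < gamma -> measurable A -> measurable B ->
  let S := Num.sqrt (sigma ^+ 2 + gamma ^+ 2) in
  let tau := sigma ^+ 2 / (sigma ^+ 2 + gamma ^+ 2) in
  ((normal_prob 0 sigma \x normal_prob 0 gamma)
    [set p | A (p.1 + p.2)%R /\ B (p.1 - tau * (p.1 + p.2))%R] =
  normal_prob 0 S A * normal_prob 0 (sigma * gamma / S) B)%E.
Proof.
move=> s0 g0 mA mB S tau.
set C := [set p | _].
have mp2 : measurable_fun setT (fun p : R * R => p.1 - tau * p.2)%R.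
  by apply: measurable_funB => //; exact: measurable_funM.
have mC : measurable C by exact: measurable_rotation.
rewrite -[LHS]/(\int[normal_prob 0 sigma]_u
  normal_prob 0 gamma (xsection C u))%E.
rewrite ge0_integral_normal//; last exact: measurable_fun_xsection.
pose f (p : R * R) : \bar R := ((normal_pdf 0 sigma p.1)%:E *
  ((normal_pdf 0 gamma (p.2 - p.1))%:E *
  ((\1_A p.2)%:E * (\1_B (p.1 - tau * p.2))%:E)))%E.
have f0 p : (0 <= f p)%E by rewrite !mule_ge0 // lee_fin ?normal_pdf_ge0.
have mf : measurable_fun setT f.
  apply: emeasurable_funM; last apply: emeasurable_funM.
  - apply/measurable_EFinP.
    by apply: (measurableT_comp (measurable_normal_pdf _ _)).
  - apply/measurable_EFinP.
    apply: (measurableT_comp (measurable_normal_pdf _ _)).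
    exact: measurable_funB.
  - apply: emeasurable_funM; apply/measurable_EFinP.
      by apply: (@measurableT_comp _ _ _ _ _ _ (\1_A : R -> R)).
    exact: (@measurableT_comp _ _ _ _ _ _ (\1_B : R -> R)).
transitivity (\int[mu]_u fubini_F mu f u)%E.
  apply: eq_integral => u _.
  rewrite normal_probE; last exact: measurable_xsection.
  rewrite -(@ge0_integral_shift _ (- u)); last 2 first.
  - by apply: measurable_pdf_indic; exact: measurable_xsection.
  - by move=> z; exact: pdf_indic_ge0.
  rewrite -ge0_integralZl//; last 3 first.
  - apply: (@measurableT_comp _ _ _ _ _ _ (fun x =>
      (normal_pdf 0 gamma x)%:E * (\1_(xsection C u) x)%:E)%E).
      by apply: measurable_pdf_indic; exact: measurable_xsection.
    exact: measurable_funD.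
  - by move=> z _; exact: pdf_indic_ge0.
  - by rewrite lee_fin normal_pdf_ge0.
  apply: eq_integral => w _; rewrite /f/= !indicE mem_xsection.
  have -> : ((u, w - u) \in C) = ((w \in A) && (u - tau * w \in B)).
    rewrite -[in RHS](subrKC u w).
    by apply/idP/andP => [/set_mem[]|[/set_mem ? /set_mem ?]]; [split|];
      exact/mem_set.
  by case: (w \in A); case: (_ \in B); rewrite ?mul1e ?mule1 ?mule0 ?mul0e.
rewrite fubini_tonelli// /fubini_G.
set s := sigma * gamma / S.
transitivity (\int[mu]_z
  ((normal_pdf 0 S z)%:E * (\1_A z)%:E * normal_prob 0 s B))%E.
  apply: eq_integral => z _.
  rewrite normal_probE// -(@ge0_integral_shift _ (- (tau * z))); last 2 first.
  - exact: measurable_pdf_indic.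
  - by move=> x; exact: pdf_indic_ge0.
  rewrite -ge0_integralZl//; last 3 first.
  - apply: (@measurableT_comp _ _ _ _ _ _ (fun x =>
      (normal_pdf 0 s x)%:E * (\1_B x)%:E)%E).
      exact: measurable_pdf_indic.
    exact: measurable_funD.
  - by move=> x _; exact: pdf_indic_ge0.
  - exact: pdf_indic_ge0.
  apply: eq_integral => u _.
  rewrite /f/= muleA -(EFinM (normal_pdf 0 sigma u)) normal_pdf_mul//.
  by rewrite -/S -/tau EFinM -!muleA; congr (_ * _)%E; rewrite muleCA.
rewrite ge0_integralZr//; last 2 first.
- exact: measurable_pdf_indic.
- by move=> z _; exact: pdf_indic_ge0.
by rewrite -normal_probE.
Qed.
End normal_plane.

Section normal_moment.
Variable R : realType.
Local Notation mu := lebesgue_measure.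

Lemma cvg_mulX_normal_pdf (s : R) : 0 < s ->
  n.+1%:R * normal_pdf 0 s n.+1%:R @[n --> \oo] --> (0 : R).
Proof.
move=> s0; pose C := normal_peak s * (s ^+ 2 *+ 2).
have H : C * (n.+1%:R)^-1 @[n --> \oo] --> (0 : R).
  rewrite -(mulr0 C); apply: cvgMr; exact: cvg_harmonic.
apply: (squeeze_cvgr _ (cvg_cst 0) H).
apply: nearW => n; set m : R := n.+1%:R.
have m0 : 0 < m by rewrite ltr0n.
rewrite mulr_ge0 ?normal_pdf_ge0 ?(ltW m0)//=.
rewrite normal_pdfE ?gt_eqF// mulrCA /C -mulrA ler_wpM2l ?normal_peak_ge0//.
rewrite /normal_fun subr0 mulNr expRN.
have k0 : 0 < m ^+ 2 / (s ^+ 2 *+ 2).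
  by rewrite divr_gt0 ?exprn_gt0// pmulrn_lgt0 ?exprn_gt0.
rewrite ler_pdivrMr ?expR_gt0//.
(* [m * expR (- x) <= m / x] with [x = m ^+ 2 / (s ^+ 2 *+ 2)]. *)
apply: (@le_trans _ _ (s ^+ 2 *+ 2 / m * (m ^+ 2 / (s ^+ 2 *+ 2)))).
  rewrite le_eqVlt; apply/orP; left; apply/eqP; field.
  by rewrite !gt_eqF.
apply: ler_wpM2l.
  by rewrite divr_ge0 ?(ltW m0)// mulrn_wge0// sqr_ge0.
by rewrite (le_trans _ (expR_ge1Dx _))// lerDr.
Qed.

Lemma is_derive_mulX_normal_pdf (s x : R) : s != 0 ->
  is_derive x 1 (fun x : R => s ^+ 2 * (x * normal_pdf 0 s x))
    (s ^+ 2 * normal_pdf 0 s x - x ^+ 2 * normal_pdf 0 s x).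
Proof.
move=> s0; rewrite normal_pdfE//.
pose k := - (s ^+ 2 *+ 2)^-1.
have kE y : normal_fun 0 s y = expR (k * y ^+ 2).
  by rewrite /normal_fun subr0 mulNr mulrC -mulNr.
under eq_fun do rewrite kE.
rewrite kE.
apply: is_derive_eq.
rewrite /GRing.scale/= !mulr1 /k.
by field.
Qed.

Let continuous_x2pdf (s : R) : s != 0 ->
  continuous (fun x : R => x ^+ 2 * normal_pdf 0 s x : R).
Proof.
move=> s0 x; apply: cvgM; first exact: exprn_continuous.
exact: continuous_normal_pdf.
Qed.

(** Integration by parts, the boundary term being the last one. *)
Let integral_0n_x2pdf (s : R) (n : nat) : 0 < s ->
  (\int[mu]_(x in `[0%R, n.+1%:R]) (x ^+ 2 * normal_pdf 0 s x)%:E =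
   (s ^+ 2)%:E * (\int[mu]_(x in `[0%R, n.+1%:R]) (normal_pdf 0 s x)%:E)
   - (s ^+ 2 * (n.+1%:R * normal_pdf 0 s n.+1%:R))%:E)%E.
Proof.
move=> s_gt0; have s0 : s != 0 by rewrite gt_eqF.
have cpdf : continuous (fun x : R => s ^+ 2 * normal_pdf 0 s x : R).
  by move=> x; apply: cvgMr; exact: continuous_normal_pdf.
have dF x := is_derive_mulX_normal_pdf x s0.
have cF : continuous (fun x : R => s ^+ 2 * (x * normal_pdf 0 s x)).
  move=> x; apply/differentiable_continuous/derivable1_diffP.
  exact: ex_derive.
have i1 : mu.-integrable `[0, n.+1%:R]
    (EFin \o (fun x => s ^+ 2 * normal_pdf 0 s x)).
  apply: continuous_compact_integrable; first exact: segment_compact.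
  exact: continuous_subspaceT.
have i2 : mu.-integrable `[0, n.+1%:R]
    (EFin \o (fun x => x ^+ 2 * normal_pdf 0 s x)).
  apply: continuous_compact_integrable; first exact: segment_compact.
  apply: continuous_subspaceT; exact: continuous_x2pdf.
have := @continuous_FTC2 R
  (fun x => s ^+ 2 * normal_pdf 0 s x - x ^+ 2 * normal_pdf 0 s x)
  (fun x => s ^+ 2 * (x * normal_pdf 0 s x)) 0 n.+1%:R.
rewrite ltr0n mul0r mulr0 sube0 => /(_ isT) FTC.
rewrite -FTC; last 3 first.
- apply: continuous_subspaceT => x; apply: cvgB; first exact: cpdf.
  exact: continuous_x2pdf.
- split; first by move=> x _; exact: ex_derive.
  + by apply: cvg_at_right_filter; exact: cF.
  + by apply: cvg_at_left_filter; exact: cF.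
- by move=> x _; rewrite derive1E derive_val.
under [X in (_ - X)%E]eq_integral do rewrite EFinB.
rewrite integralB_EFin//.
rewrite -ge0_integralZl//; last 3 first.
- apply/measurable_EFinP/measurable_funTS; exact: measurable_normal_pdf.
- by move=> x _; rewrite lee_fin normal_pdf_ge0.
- by rewrite lee_fin sqr_ge0.
under [in X in (X - _)%E]eq_integral do rewrite -EFinM.
rewrite oppeB; last first.
  by rewrite fin_num_adde_defr// integrable_fin_num.
rewrite addeA subee ?add0e//.
exact: integrable_fin_num.
Qed.

(** By parity the integral is twice the one over the half-line, where it is the
limit of the integrals over [[0, n]]. *)
Lemma normal_moment2 (s : R) : 0 < s ->
  (\int[normal_prob 0 s]_x (x ^+ 2)%:E = (s ^+ 2)%:E)%E.
Proof.
move=> s_gt0; have s0 : s != 0 by rewrite gt_eqF.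
have x2ge0 (x : R) : 0 <= x ^+ 2 * normal_pdf 0 s x.
  by rewrite mulr_ge0 ?sqr_ge0 ?normal_pdf_ge0.
rewrite ge0_integral_normal//; last first.
- by move=> x; rewrite lee_fin sqr_ge0.
- exact/measurable_EFinP.
under eq_integral do rewrite -EFinM mulrC.
have even_pdf : normal_pdf 0 s =1 normal_pdf 0 s \o -%R.
  by move=> x /=; rewrite normal_pdfE// /normal_fun !subr0 sqrrN.
rewrite (@ge0_symfun_integralT _
  (fun x => x ^+ 2 * normal_pdf 0 s x))//; last 2 first.
- exact: continuous_x2pdf.
- move=> x /=; rewrite sqrrN.
  by rewrite -[normal_pdf 0 s (- x)]/((normal_pdf 0 s \o -%R) x) -even_pdf.
have := integral_normal_pdf 0 s.
rewrite (ge0_symfun_integralT (normal_pdf_ge0 _ _))//; last first.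
  exact: continuous_normal_pdf.
rewrite (_ : [set x | _] = `[0, +oo[%classic); last first.
  by apply/seteqP; split => x/=; rewrite in_itv/= andbT.
set I := (\int[mu]_(x in _) _)%E => I2.
have Ifin : I \is a fin_num.
  apply: integrable_fin_num => //.
  apply: (integrableS _ _ (@subsetT _ _)) => //.
  exact: integrable_normal_pdf.
suff -> : (\int[mu]_(x in `[0%R, +oo[) (x ^+ 2 * normal_pdf 0 s x)%:E =
    (s ^+ 2)%:E * I)%E.
  by rewrite muleCA I2 mule1.
have mx2 : measurable_fun [set: R] (fun x => x ^+ 2 * normal_pdf 0 s x).
  by apply: measurable_funM => //; exact: measurable_normal_pdf.
have := @ge0_cvgn_integral _ mu _ x2ge0 mx2.
rewrite -cvg_shiftS => /cvg_lim <- //.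
apply/cvg_lim => //.
under eq_fun do rewrite integral_0n_x2pdf//.
rewrite -[((s ^+ 2)%:E * I)%E]sube0; apply: cvgeB.
- by rewrite oppe0; exact: fin_num_adde_defl.
  apply: cvgeZl => //.
  have := @ge0_cvgn_integral _ mu _ (normal_pdf_ge0 0 s)
    (measurable_normal_pdf 0 s).
  by rewrite -cvg_shiftS.
apply: cvg_EFin; first exact: nearW.
rewrite -[X in _ --> (X : R)](mulr0 (s ^+ 2)).
by apply: cvgMr; exact: cvg_mulX_normal_pdf.
Qed.

End normal_moment.

(** * Borel sets of column vectors *)

Section cV.
Context {R : realType} {n : nat}.

Lemma measurable_coord (i : 'I_n) :
  measurable_fun [set: 'cV[R]_n] (fun x : 'cV[R]_n => x i 0).
Proof.
move=> _ B mB; rewrite setTI; apply: sub_sigma_algebra => /=.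
rewrite -bigcup_seq/=; exists i => /=; first by rewrite mem_index_enum.
by exists B => //; rewrite setTI.
Qed.

Lemma measurable_fun_cV d (T : measurableType d) (f : T -> 'cV[R]_n) :
  (forall i, measurable_fun [set: T] (fun t => f t i 0)) ->
  measurable_fun [set: T] f.
Proof.
move=> mf; apply: (measurability
  (\big[setU/set0]_(i < n) preimage_set_system setT
     (fun x : 'cV[R]_n => x i 0) measurable)) => //.
move=> _ [B + <-]; rewrite -bigcup_seq/= => -[i _ [C mC <-]].
by rewrite setTI; exact: mf.
Qed.

Definition cV_box (B : 'I_n -> set R) : set 'cV[R]_n :=
  [set x | forall i, B i (x i 0)].

Lemma measurable_cV_box (B : 'I_n -> set R) :
  (forall i, measurable (B i)) -> measurable (cV_box B).
Proof.
move=> mB.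
rewrite (_ : cV_box B = \bigcap_i (if insub i is Some j
    then (fun x : 'cV[R]_n => x j 0) @^-1` (B j) else setT)).
  apply: bigcapT_measurable => i; case: insubP => // j _ _.
  rewrite -[X in measurable X]setTI; exact: measurable_coord.
apply/seteqP; split => x /= Bx i.
  by move=> _; case: insubP => // j _ _; exact: Bx.
by have := Bx i I; rewrite valK.
Qed.

Lemma cV_measure_unique (m1 m2 : {measure set 'cV[R]_n -> \bar R}) :
  (m1 setT < +oo)%E ->
  (forall B : 'I_n -> set R, (forall i, measurable (B i)) ->
    m1 (cV_box B) = m2 (cV_box B)) ->
  forall A, measurable A -> m1 A = m2 A.
Proof.
move=> m1oo m12.
pose G : set (set 'cV[R]_n) := [set A | exists2 B : 'I_n -> set R,
  (forall i, measurable (B i)) & A = cV_box B].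
have GT : G setT.
  exists (fun=> setT) => //; by apply/seteqP; split.
apply: (measure_unique G (fun=> setT)) => //.
- apply/seteqP; split => A.
    apply: smallest_sub; first exact: smallest_sigma_algebra.
    move=> {}A; rewrite -bigcup_seq/= => -[i _ [C mC <-]].
    apply: sub_sigma_algebra; exists (fun j => if j == i then C else setT).
      by move=> j; case: ifP.
    rewrite setTI; apply/seteqP; split => x /=.
      by move=> Cx j; case: eqP => // ->.
    by move=> /(_ i); rewrite eqxx.
  apply: smallest_sub; first exact: sigma_algebra_measurable.
  by move=> {}A [B mB ->]; exact: measurable_cV_box.
- move=> A B [A' mA ->] [B' mB ->].
  exists (fun i => A' i `&` B' i); first by move=> i; exact: measurableI.
  apply/seteqP; split => x /=.
    by move=> [h1 h2] i; split; [exact: h1|exact: h2].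
  by move=> h; split => i; have [] := h i.
- by rewrite bigcup_const//; exact: nat_nonempty.
- by move=> A [B mB ->]; exact: m12.
Qed.

End cV.

Lemma rect_measure_unique d1 d2 (T1 : measurableType d1)
    (T2 : measurableType d2) (R : realType)
    (m1 m2 : {measure set (T1 * T2) -> \bar R}) :
  (m1 setT < +oo)%E ->
  (forall A B, measurable A -> measurable B -> m1 (A `*` B) = m2 (A `*` B)) ->
  forall C, measurable C -> m1 C = m2 C.
Proof.
move=> m1oo m12.
pose G : set (set (T1 * T2)) := [set C | exists2 A, measurable A &
  exists2 B, measurable B & A `*` B = C].
apply: (measure_unique G (fun=> setT)) => //.
- by rewrite measurable_prod_measurableType.
- move=> _ _ [A mA [B mB <-]] [A' mA' [B' mB' <-]].
  rewrite -setXI; exists (A `&` A'); first exact: measurableI.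
  by exists (B `&` B') => //; exact: measurableI.
- by move=> _; exists setT => //; exists setT => //; rewrite setXTT.
- by rewrite bigcup_const//; exact: nat_nonempty.
- by move=> C [A mA [B mB <-]]; exact: m12.
Qed.

(** * Independence of the residual and the randomized response *)

Section joint_law.
Context d d1 d2 (T : measurableType d) (T1 : measurableType d1)
  (T2 : measurableType d2) (R : realType) (P : probability T R) (n : nat)
  (Z : 'I_n -> T -> T1 * T2) (M : 'I_n -> probability (T1 * T2)%type R).
Hypothesis mZ : forall i, measurable_fun setT (Z i).

Let measurable_all (Q : pred 'I_n) (C : 'I_n -> set (T1 * T2)) :
  (forall i, measurable (C i)) ->
  measurable [set t | forall i, Q i -> C i (Z i t)].
Proof.
move=> mC.
rewrite (_ : mkset _ = \bigcap_k
    (if insub k is Some i then if Q i then Z i @^-1` C i else setT else setT)).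
  apply: bigcapT_measurable => k; case: insubP => // i _ _; case: ifP => // _.
  by rewrite -[X in measurable X]setTI; exact: mZ.
apply/seteqP; split => t /= h i.
  by move=> _; case: insubP => // j _ _; case: ifP => // Qj; exact: h.
by have := h i I; rewrite valK => + Qi; rewrite Qi.
Qed.

(** When each [M i] is a product measure, this is the grouping principle: pairs
formed from independent variables are independent. The rectangles are replaced
by general sets one pair at a time, the other pairs being frozen, so that each
step compares two finite measures that agree on rectangles. *)
Lemma joint_law_of_rectangles :
  (forall A B, (forall i, measurable (A i)) -> (forall i, measurable (B i)) ->
    P [set t | forall i, (A i `*` B i) (Z i t)] =
    (\prod_(i < n) M i (A i `*` B i))%E) ->
  forall C, (forall i, measurable (C i)) ->
    P [set t | forall i, C i (Z i t)] = (\prod_(i < n) M i (C i))%E.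
Proof.
move=> rectE.
(* From the index [k] on, the sets are still rectangles. *)
suff rec k C : (forall i, measurable (C i)) ->
    (forall i : 'I_n, (k <= i)%N ->
      exists A B, [/\ measurable A, measurable B & C i = A `*` B]) ->
    P [set t | forall i, C i (Z i t)] = (\prod_(i < n) M i (C i))%E.
  move=> C mC; apply: (rec n) => // i; by rewrite leqNgt ltn_ord.
elim: k C => [|k IH] C mC rC.
  have /choice[A /choice[B AB]] := fun i => rC i (leq0n _).
  rewrite (_ : C = fun i => A i `*` B i).
    by apply: rectE => i; have [] := AB i.
  by apply/funext => i; have [] := AB i.
have [nk|kn] := leqP n k.
  apply: IH => // i ki.
  by move: (leq_ltn_trans (leq_trans nk ki) (ltn_ord i)); rewrite ltnn.
pose i0 := Ordinal kn.
pose E := [set t | forall i, i != i0 -> C i (Z i t)].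
have mE : measurable E by exact: measurable_all.
pose c := \prod_(i < n | i != i0) fine (M i (C i)).
have c0 : 0 <= c by apply: prodr_ge0 => i _; exact: fine_ge0.
pose D' D i := if i == i0 then D else C i.
have mD' D : measurable D -> forall i, measurable (D' D i).
  by move=> mD i; rewrite /D'; case: ifP.
have setE D : [set t | forall i, D' D i (Z i t)] = Z i0 @^-1` D `&` E.
  apply/seteqP; split => t /= h.
    split; first by have := h i0; rewrite /D' eqxx.
    by move=> i /negbTE ii0; have := h i; rewrite /D' ii0.
  by move=> i; rewrite /D'; case: eqP => [->|/eqP]; [exact: h.1|exact: h.2].
have prodE D : measurable D -> (\prod_(i < n) M i (D' D i) = c%:E * M i0 D)%E.
  move=> mD; rewrite (bigD1 i0)//= {1}/D' eqxx muleC; congr (_ * _)%E.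
  rewrite /c -prodEFin; apply: eq_bigr => i /negbTE ii0.
  by rewrite /D' ii0 fineK// fin_num_measure.
have mZ0 : measurable_fun setT (Z i0) by [].
pose m1 : {measure set (T1 * T2) -> \bar R} :=
  pushforward (mrestr P mE) (Z i0).
pose m2 : {measure set (T1 * T2) -> \bar R} := mscale (NngNum c0) (M i0).
have CE : C = D' (C i0).
  by apply/funext => i; rewrite /D'; case: eqP => // ->.
rewrite CE setE prodE//.
rewrite -[LHS]/(m1 mZ0 (C i0)) -[RHS]/(m2 (C i0)).
apply: (@rect_measure_unique _ _ _ _ _ (m1 mZ0) m2) => //.
  rewrite /m1/= /pushforward/= /mrestr.
  rewrite (le_lt_trans (probability_le1 _ _)) ?ltry//.
  by rewrite preimage_setT setTI.
move=> A B mA mB.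
have mAB : measurable (A `*` B) by exact: measurableX.
rewrite -[LHS]/(P (Z i0 @^-1` (A `*` B) `&` E)) -setE IH//.
- by rewrite prodE.
- exact: mD'.
- move=> i; rewrite leq_eqVlt => /predU1P[ki|ki]; last first.
    rewrite /D'; have /negbTE -> : i != i0 by rewrite -val_eqE/= gtn_eqF.
    exact: rC.
  exists A, B; split => //; rewrite /D'.
  have ii0 : i = i0 by apply: val_inj; rewrite /= -ki.
  by rewrite ii0 eqxx.
Qed.
End joint_law.

(** Boxes form an intersection-stable generator of the Borel sets, so that the
product rule extends from boxes to Borel sets, in one argument at a time. *)
Lemma independent_RV_boxes d (T : measurableType d) (R : realType)
    (P : probability T R) (n k : nat)
    (U : {RV P >-> 'cV[R]_n}) (e : {RV P >-> 'cV[R]_k}) :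
  (forall A B, (forall i, measurable (A i)) -> (forall i, measurable (B i)) ->
    P (U @^-1` cV_box A `&` e @^-1` cV_box B) =
    (P (U @^-1` cV_box A) * P (e @^-1` cV_box B))%E) ->
  independent_RV U e.
Proof.
move=> boxE.
have step1 A' B : (forall i, measurable (A' i)) -> measurable B ->
    P (U @^-1` cV_box A' `&` e @^-1` B) =
    (P (U @^-1` cV_box A') * P (e @^-1` B))%E.
  move=> mA' mB; set A := U @^-1` cV_box A'.
  have mA : measurable A.
    by rewrite -[X in measurable X]setTI; apply: measurable_funP => //;
      exact: measurable_cV_box.
  have me : measurable_fun setT e by [].
  pose m1 : {measure set 'cV[R]_k -> \bar R} :=
    pushforward (mrestr P mA) e.
  have c0 : 0 <= fine (P A) by exact: fine_ge0.
  pose m2 : {measure set 'cV[R]_k -> \bar R} :=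
    mscale (NngNum c0) (distribution P e).
  have -> : (P A * P (e @^-1` B) = m2 B)%E.
    rewrite -[RHS]/((fine (P A))%:E * P (e @^-1` B))%E fineK//.
    by rewrite fin_num_measure.
  rewrite setIC -[LHS]/(m1 me B).
  apply: (@cV_measure_unique _ _ (m1 me) m2) => //.
    rewrite /m1/= /pushforward/= /mrestr.
    rewrite (le_lt_trans (probability_le1 _ _)) ?ltry//.
    by rewrite preimage_setT setTI.
  move=> B' mB'.
  rewrite -[LHS]/(P (e @^-1` cV_box B' `&` A)).
  rewrite -[RHS]/((fine (P A))%:E * P (e @^-1` cV_box B'))%E.
  rewrite fineK ?fin_num_measure//.
  by rewrite setIC boxE.
move=> A B mA mB.
set E := e @^-1` B.
have mE : measurable E.
  by rewrite -[X in measurable X]setTI; exact: measurable_funP.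
have mU : measurable_fun setT U by [].
pose m1 : {measure set 'cV[R]_n -> \bar R} := pushforward (mrestr P mE) U.
have c0 : 0 <= fine (P E) by exact: fine_ge0.
pose m2 : {measure set 'cV[R]_n -> \bar R} :=
  mscale (NngNum c0) (distribution P U).
have -> : (P (U @^-1` A) * P E = m2 A)%E.
  rewrite muleC -[RHS]/((fine (P E))%:E * P (U @^-1` A))%E fineK//.
  by rewrite fin_num_measure.
rewrite -[LHS]/(m1 mU A).
apply: (@cV_measure_unique _ _ (m1 mU) m2) => //.
  rewrite /m1/= /pushforward/= /mrestr.
  rewrite (le_lt_trans (probability_le1 _ _)) ?ltry//.
  by rewrite preimage_setT setTI.
move=> A' mA'.
rewrite -[LHS]/(P (U @^-1` cV_box A' `&` E)).
rewrite -[RHS]/((fine (P E))%:E * P (U @^-1` cV_box A'))%E.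
rewrite fineK ?fin_num_measure//.
by rewrite muleC step1.
Qed.

Lemma isotropic_center d (T : measurableType d) (R : realType)
    (P : probability T R) (n : nat) (s : R) (m : 'cV[R]_n)
    (y : {RV P >-> 'cV[R]_n}) :
  s != 0 -> isotropic_normal m s (distribution P y) ->
  exists2 z : {RV P >-> 'cV[R]_n}, forall t, z t = y t - m &
    isotropic_normal 0 s (distribution P z).
Proof.
move=> s0 ylaw; pose z0 t := y t - m.
have mz0 : measurable_fun setT z0.
  apply: measurable_fun_cV => i.
  under eq_fun do rewrite !mxE.
  apply: measurable_funB => //.
  by apply: (measurableT_comp (measurable_coord i)).
pose z : {RV P >-> 'cV[R]_n} :=
  HB.pack z0 (isMeasurableFun.Build _ _ _ _ _ mz0).
exists z => // B mB.
pose B' i := (fun x => x - m i 0) @^-1` B i.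
have mB' i : measurable (B' i).
  rewrite -[X in measurable X]setTI.
  have mf : measurable_fun [set: R] (fun x : R => x - m i 0).
    exact: measurable_funB.
  exact: (mf measurableT (B i) (mB i)).
transitivity (distribution P y (cV_box B')).
  congr (P _); apply/seteqP; split => t /= h i; have := h i;
    by rewrite /= /z0 !mxE.
rewrite ylaw//; apply: eq_bigr => i _; rewrite mxE.
exact: (@normal_prob_center R (m i 0) s (B i) s0 (mB i)).
Qed.

(** The centered response [z] splits into a multiple of the randomized response
[U] and a residual [e] that is independent of [U]. The joint law of [U] and [e]
on boxes is the product, over the coordinates, of the planar laws given by
[normal_rotation]. *)
Lemma gaussian_decomposition d (T : measurableType d) (R : realType)
    (P : probability T R) (n : nat) (sigma gamma : R)
    (z omega : {RV P >-> 'cV[R]_n}) :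
  0 < sigma -> 0 < gamma ->
  isotropic_normal 0 sigma (distribution P z) ->
  isotropic_normal 0 gamma (distribution P omega) ->
  independent_RV z omega ->
  let tau := sigma ^+ 2 / (sigma ^+ 2 + gamma ^+ 2) in
  exists U e : {RV P >-> 'cV[R]_n},
    [/\ forall t, U t = z t + omega t,
        forall t, z t = tau *: U t + e t,
        independent_RV U e &
        isotropic_normal 0
          (sigma * gamma / Num.sqrt (sigma ^+ 2 + gamma ^+ 2))
          (distribution P e)].
Proof.
move=> s0 g0 zlaw wlaw zw tau.
set S := Num.sqrt _; set s := _ / S.
have mz i : measurable_fun setT (fun t => z t i 0).
  by apply: (measurableT_comp (measurable_coord i)).
have mw i : measurable_fun setT (fun t => omega t i 0).
  by apply: (measurableT_comp (measurable_coord i)).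
pose U0 t := z t + omega t.
have mU0 : measurable_fun setT U0.
  apply: measurable_fun_cV => i.
  under eq_fun do rewrite mxE.
  exact: measurable_funD.
pose e0 t := z t - tau *: U0 t.
have me0 : measurable_fun setT e0.
  apply: measurable_fun_cV => i.
  under eq_fun do rewrite !mxE.
  apply: measurable_funB => //; apply: measurable_funM => //.
  exact: measurable_funD.
pose U : {RV P >-> 'cV[R]_n} :=
  HB.pack U0 (isMeasurableFun.Build _ _ _ _ _ mU0).
pose e : {RV P >-> 'cV[R]_n} :=
  HB.pack e0 (isMeasurableFun.Build _ _ _ _ _ me0).
pose Z (i : 'I_n) t : measurableTypeR R * measurableTypeR R :=
  (z t i 0, omega t i 0).
have mZ i : measurable_fun setT (Z i).
  apply: measurable_fun_pair; [exact: mz|exact: mw].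
pose M (i : 'I_n) :
    probability (measurableTypeR R * measurableTypeR R)%type R :=
  (normal_prob 0 sigma \x normal_prob 0 gamma)%E.
have Zlaw C : (forall i, measurable (C i)) ->
    P [set t | forall i, C i (Z i t)] = (\prod_(i < n) M i (C i))%E.
  apply: joint_law_of_rectangles => // A B mA mB.
  rewrite (_ : [set t | _] =
    z @^-1` cV_box A `&` omega @^-1` cV_box B); last first.
    apply/seteqP; split => t /=; first by move=> h; split => i; have [] := h i.
    by move=> [h1 h2] i; split; [exact: h1|exact: h2].
  rewrite zw; [|exact: measurable_cV_box..].
  rewrite -[P (z @^-1` _)]/(distribution P z (cV_box A)) zlaw//.
  rewrite -[P (omega @^-1` _)]/(distribution P omega (cV_box B)) wlaw//.
  rewrite -big_split/=; apply: eq_bigr => i _; rewrite !mxE.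
  exact/esym/product_measure1E.
have law A B : (forall i, measurable (A i)) -> (forall i, measurable (B i)) ->
    P (U @^-1` cV_box A `&` e @^-1` cV_box B) =
    (\prod_(i < n) normal_prob 0 S (A i) *
     \prod_(i < n) normal_prob 0 s (B i))%E.
  move=> mA mB.
  pose C (i : 'I_n) : set (measurableTypeR R * measurableTypeR R) :=
    [set p | A i (p.1 + p.2)%R /\ B i (p.1 - tau * (p.1 + p.2))%R].
  have mC i : measurable (C i).
    exact: (measurable_rotation tau (mA i) (mB i)).
  transitivity (\prod_(i < n) M i (C i))%E; last first.
    rewrite -big_split/=; apply: eq_bigr => i _.
    exact: (normal_rotation s0 g0 (mA i) (mB i)).
  rewrite -(Zlaw C mC); congr (P _); apply/seteqP; split => t /=.
    move=> [h1 h2] i; have := h1 i; have := h2 i.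
    by rewrite /= /e0 /U0 /C !mxE.
  by move=> h; split => i; have [] := h i; rewrite /= /e0 /U0 !mxE.
have one_prod r : (1 = \prod_(i < n) normal_prob 0 r (@setT R))%E.
  rewrite big1// => i _.
  exact: (@probability_setT _ _ _
    (normal_prob 0 r : probability (measurableTypeR R) R)).
have box_T : cV_box (fun=> setT) = [set: 'cV[R]_n] by apply/seteqP; split.
have elaw B : (forall i, measurable (B i)) ->
    P (e @^-1` cV_box B) = (\prod_(i < n) normal_prob 0 s (B i))%E.
  move=> mB; have := law (fun=> setT) B (fun=> measurableT) mB.
  by rewrite box_T preimage_setT setTI -one_prod mul1e.
have Ulaw A : (forall i, measurable (A i)) ->
    P (U @^-1` cV_box A) = (\prod_(i < n) normal_prob 0 S (A i))%E.
  move=> mA; have := law A (fun=> setT) mA (fun=> measurableT).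
  by rewrite box_T preimage_setT setIT -one_prod mule1.
exists U, e; split; first by [].
- by move=> t; rewrite /= /e0 [RHS]addrC subrK.
- by apply: independent_RV_boxes => A B mA mB; rewrite law// Ulaw// elaw.
- move=> B mB; rewrite -[LHS]/(P (e @^-1` cV_box B)) elaw//.
  by apply: eq_bigr => i _; rewrite mxE.
Qed.

(** * Quadratic functionals of an isotropic normal vector *)

Section isotropic.
Context (R : realType) (n : nat) (s : R) (s_gt0 : 0 < s).
Variable mu : probability 'cV[R]_n R.
Hypothesis mu_normal : isotropic_normal 0 s mu.

Let normal_setT : normal_prob 0 s (@setT R) = 1%E.
Proof.
exact: (@probability_setT _ _ _
  (normal_prob 0 s : probability (measurableTypeR R) R)).
Qed.

Lemma isotropic_coord_law (k : 'I_n) (B : set R) : measurable B ->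
  mu ((fun x : 'cV[R]_n => x k 0) @^-1` B) = normal_prob 0 s B.
Proof.
move=> mB; pose C i := if i == k then B else setT.
transitivity (mu [set x : 'cV[R]_n | forall i, C i (x i 0)]).
  congr (mu _); apply/seteqP; split => x /=.
    by move=> Bx i; rewrite /C; case: eqP => // ->.
  by move=> /(_ k); rewrite /C eqxx.
rewrite mu_normal; last by move=> i; rewrite /C; case: ifP.
rewrite (bigD1 k)//= [X in (_ * X)%E]big1 ?mule1; last first.
  by move=> i /negbTE ik; rewrite /C ik mxE normal_setT.
by rewrite /C eqxx mxE.
Qed.

Lemma isotropic_coord_moment2 (k : 'I_n) :
  (\int[mu]_x (x k 0 ^+ 2)%:E = (s ^+ 2)%:E)%E.
Proof.
rewrite -(normal_moment2 s_gt0).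
pose ck (x : 'cV[R]_n) : measurableTypeR R := x k 0.
have mk : measurable_fun setT ck by exact: measurable_coord.
have m2 : measurable_fun setT (fun x : measurableTypeR R => (x ^+ 2)%:E).
  exact/measurable_EFinP.
transitivity (\int[pushforward mu ck]_x (x ^+ 2)%:E)%E.
  rewrite ge0_integral_pushforward//.
  by move=> x _; rewrite lee_fin sqr_ge0.
apply: eq_measure_integral => A mA _; exact: isotropic_coord_law.
Qed.

Definition sign_flip (k : 'I_n) (x : 'cV[R]_n) : 'cV[R]_n :=
  \col_i (if i == k then - x i 0 else x i 0).

Lemma measurable_sign_flip k : measurable_fun setT (sign_flip k).
Proof.
apply: measurable_fun_cV => i; rewrite /sign_flip.
under eq_fun do rewrite mxE.
have [_|_] := eqVneq i k; last exact: measurable_coord.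
apply: (@measurableT_comp _ _ _ _ _ _ (-%R : R -> R)).
  exact: oppr_measurable.
exact: measurable_coord.
Qed.

Lemma isotropic_sign_flip (k : 'I_n) (A : set 'cV[R]_n) : measurable A ->
  mu (sign_flip k @^-1` A) = mu A.
Proof.
move=> mA; have mf := measurable_sign_flip k.
pose m1 : {measure set 'cV[R]_n -> \bar R} := pushforward mu (sign_flip k).
rewrite -[LHS]/(m1 mf A).
apply: (@cV_measure_unique _ _ (m1 mf) mu) => //.
  by rewrite /m1/= /pushforward/= preimage_setT probability_setT ltry.
move=> B mB; rewrite -[LHS]/(mu (sign_flip k @^-1` cV_box B)).
pose B' i := if i == k then -%R @^-1` B i else B i.
have mB' i : measurable (B' i).
  rewrite /B'; case: ifP => // _; rewrite -[X in measurable X]setTI.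
  have mo : measurable_fun [set: R] (-%R : R -> R) by exact: oppr_measurable.
  exact: (mo measurableT (B i) (mB i)).
rewrite (_ : sign_flip k @^-1` cV_box B = cV_box B'); last first.
  apply/seteqP; split => x /= h i; have := h i; rewrite /sign_flip mxE /B';
    by case: ifP.
rewrite [LHS]mu_normal// [RHS]mu_normal//; apply: eq_bigr => i _.
rewrite /B' mxE; case: ifP => // _.
apply: (@normal_prob_opp _ s (B i)) => //; by rewrite gt_eqF.
Qed.

(** The law is invariant under the change of sign of one coordinate. Averaging
the square over [x] and its reflection cancels the cross term of that
coordinate, so that no integrability of mixed products enters. *)
Lemma isotropic_quadratic (a : 'I_n -> R) (c : R) (r : seq 'I_n) : uniq r ->
  (\int[mu]_x ((c + \sum_(i <- r) a i * x i 0) ^+ 2)%:E =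
  (c ^+ 2 + s ^+ 2 * \sum_(i <- r) a i ^+ 2)%:E)%E.
Proof.
elim: r => [_|k r IH /= /andP[kr ur]].
  under eq_integral do rewrite big_nil addr0.
  rewrite big_nil mulr0 addr0 integral_cst// -[RHS]mule1; congr (_ * _)%E.
  exact: probability_setT.
pose h (x : 'cV[R]_n) := c + \sum_(i <- r) a i * x i 0.
have mh : measurable_fun setT h.
  apply: measurable_funD => //; apply: measurable_sum => i.
  by apply: measurable_funM => //; exact: measurable_coord.
pose f (x : 'cV[R]_n) := (h x + a k * x k 0) ^+ 2.
pose f' (x : 'cV[R]_n) := (h x - a k * x k 0) ^+ 2.
have mak : measurable_fun setT (fun x : 'cV[R]_n => a k * x k 0).
  by apply: measurable_funM => //; exact: measurable_coord.
have mf : measurable_fun setT f.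
  by apply: measurable_funX; exact: measurable_funD.
have mf' : measurable_fun setT f'.
  by apply: measurable_funX; exact: measurable_funB.
have ff' : (\int[mu]_x (f x)%:E = \int[mu]_x (f' x)%:E)%E.
  transitivity (\int[pushforward mu (sign_flip k)]_x (f x)%:E)%E.
    apply: eq_measure_integral; first exact: measurable_sign_flip.
    by move=> mfl A mA _; exact/esym/isotropic_sign_flip.
  rewrite ge0_integral_pushforward//; last 3 first.
  - exact: measurable_sign_flip.
  - exact/measurable_EFinP.
  - by move=> x _; rewrite lee_fin sqr_ge0.
  apply: eq_integral => x _ /=; congr EFin; congr (_ ^+ 2).
  rewrite /sign_flip mxE eqxx mulrN; congr (_ - _); congr (_ + _).
  rewrite big_seq [RHS]big_seq; apply: eq_bigr => i ir; rewrite mxE.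
  by case: eqP => // ik; move: kr; rewrite -ik ir.
have I2 : (\int[mu]_x (f x)%:E + \int[mu]_x (f x)%:E =
   (2 * (c ^+ 2 + s ^+ 2 * \sum_(i <- k :: r) a i ^+ 2))%:E)%E.
  rewrite {2}ff' -ge0_integralD//; last 4 first.
  - by move=> x _; rewrite lee_fin sqr_ge0.
  - exact/measurable_EFinP.
  - by move=> x _; rewrite lee_fin sqr_ge0.
  - exact/measurable_EFinP.
  transitivity (\int[mu]_x (2%:E * (h x ^+ 2)%:E +
      (2 * a k ^+ 2)%:E * (x k 0 ^+ 2)%:E))%E.
    apply: eq_integral => x _; rewrite -!EFinM -!EFinD; congr EFin.
    by rewrite /f /f'; ring.
  have mh2 : measurable_fun setT (fun x => (h x ^+ 2)%:E).
    by apply/measurable_EFinP; exact: measurable_funX.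
  have mk2 : measurable_fun setT (fun x : 'cV[R]_n => (x k 0 ^+ 2)%:E).
    by apply/measurable_EFinP; apply: measurable_funX; exact: measurable_coord.
  have ak0 : (0 <= (2 * a k ^+ 2)%:E)%E by rewrite lee_fin mulr_ge0 ?sqr_ge0.
  rewrite ge0_integralD//; last 4 first.
  - by move=> x _; rewrite mule_ge0// lee_fin sqr_ge0.
  - exact: measurable_funeM.
  - by move=> x _; rewrite mule_ge0// lee_fin sqr_ge0.
  - exact: measurable_funeM.
  rewrite !ge0_integralZl//; try by move=> x _; rewrite lee_fin sqr_ge0.
  rewrite isotropic_coord_moment2 IH// -!EFinM -EFinD big_cons; congr EFin.
  by ring.
under eq_integral do rewrite big_cons addrCA addrC.
rewrite -/(f _) in I2 *.
move: I2; case: (\int[mu]_x _)%E => [v| |]//= [v2].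
congr EFin; lra.
Qed.

End isotropic.

Lemma ge0_integral_independent d (T : measurableType d) d1 d2
    (T1 : measurableType d1) (T2 : measurableType d2) (R : realType)
    (P : probability T R) (U : {RV P >-> T1}) (e : {RV P >-> T2})
    (A : set T1) (f : T1 * T2 -> \bar R) :
  independent_RV U e -> measurable A ->
  measurable_fun setT f -> (forall z, 0 <= f z)%E ->
  (\int[P]_(t in U @^-1` A) f (U t, e t) =
   \int[distribution P U]_(u in A) \int[distribution P e]_x f (u, x))%E.
Proof.
move=> Ue mA mf f0.
have mUe : measurable_fun setT (fun t => (U t, e t)).
  exact: measurable_fun_pair.
pose h t := (U t, e t).
have mAT : measurable (A `*` [set: T2]) by exact: measurableX.
have mfA : measurable_fun setT (f \_ (A `*` setT)).
  by apply/(measurable_restrictT _ mAT); exact: measurable_funTS.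
have fA0 z : (0 <= (f \_ (A `*` setT)) z)%E by rewrite patchE; case: ifP.
transitivity (\int[pushforward P h]_(z in A `*` setT) f z)%E.
  rewrite ge0_integral_pushforward//; last exact: measurable_funTS.
  by congr integral; apply/seteqP; split => t //= -[].
transitivity
  (\int[(distribution P U \x distribution P e)%E]_(z in A `*` setT) f z)%E.
  apply: eq_measure_integral => B mB _.
  by apply/esym/product_measure_unique.
rewrite integral_mkcond fubini_tonelli1// [RHS]integral_mkcond.
apply: eq_integral => u _; rewrite /fubini_F patchE.
case: ifPn => uA.
  apply: eq_integral => x _; rewrite patchE ifT//.
  by apply/mem_set; split => //; exact: set_mem.
apply: integral0_eq => x _; rewrite patchE ifF//; apply/negbTE.
by apply: contra uA => /set_mem[? _]; exact/mem_set.
Qed.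

(** Given [U], the noise [e] still has mean zero and covariance [s^2 I], hence
the conditional mean of the square is [g(U)^2 + s^2 |a|^2]. *)
Lemma integral_sqr_add_noise_ge d (T : measurableType d) d1
    (T1 : measurableType d1) (R : realType) (n : nat)
    (P : probability T R) (U : {RV P >-> T1}) (e : {RV P >-> 'cV[R]_n})
    (s : R) (A : set T1) (g : T1 -> R) (a : 'I_n -> R) :
  0 < s -> independent_RV U e -> isotropic_normal 0 s (distribution P e) ->
  measurable A -> measurable_fun setT g ->
  ((s ^+ 2 * \sum_i a i ^+ 2)%:E * P (U @^-1` A) <=
  \int[P]_(t in U @^-1` A) ((g (U t) + \sum_i a i * e t i 0) ^+ 2)%:E)%E.
Proof.
move=> s0 Ue elaw mA mg.
pose f (z : T1 * 'cV[R]_n) := ((g z.1 + \sum_i a i * z.2 i 0) ^+ 2)%:E.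
have mf : measurable_fun setT f.
  apply/measurable_EFinP/measurable_funX/measurable_funD.
    exact: (measurableT_comp mg).
  apply: measurable_sum => i; apply: measurable_funM => //.
  by apply: (measurableT_comp (measurable_coord i)).
have f0 z : (0 <= f z)%E by rewrite lee_fin sqr_ge0.
rewrite (ge0_integral_independent Ue mA mf f0).
rewrite -[P _]/(distribution P U A) -integral_cst//.
apply: ge0_le_integral => //.
- move=> u _; rewrite lee_fin mulr_ge0 ?sqr_ge0// sumr_ge0// => i _.
  exact: sqr_ge0.
- apply: measurable_funTS; exact: measurable_fun_fubini_tonelli_F.
- move=> u _; rewrite /f/=.
  have -> := isotropic_quadratic s0 elaw a (g u) (index_enum_uniq _).
  by rewrite lee_fin lerDr sqr_ge0.
Qed.

(** * Averaging over the selection outcome *)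

Section selective.
Context d d1 d2 (T : measurableType d) (T1 : measurableType d1)
  (S : measurableType d2) (R : realType) (P : probability T R)
  (Y : {RV P >-> T1}) (Q : T -> S) (K : {mfun S >-> pprobability T1 R}).
Hypothesis mQ : measurable_fun setT Q.

Let Kq (q : S) : {measure set T1 -> \bar R} := (K q : probability T1 R).

Lemma measurable_selective_prob B : measurable B ->
  measurable_fun setT (fun q => Kq q B).
Proof.
move=> mB; have mK : measurable_fun setT K by [].
exact: (measurable_kernel (kprobability mK) B mB).
Qed.

Lemma measurable_int_selective (f : T1 -> \bar R) :
  measurable_fun setT f -> (forall x, 0 <= f x)%E ->
  measurable_fun setT (fun q => \int[Kq q]_x f x)%E.
Proof.
move=> mf f0; apply: measurable_fun_integral_kernel => //.
exact: measurable_selective_prob.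
Qed.

Hypothesis K_sel : selective_distribution Y Q K.

Lemma ge0_integral_selective (A : set S) (f : T1 -> \bar R) : measurable A ->
  measurable_fun setT f -> (forall x, 0 <= f x)%E ->
  (\int[P]_(t in Q @^-1` A) f (Y t) =
   \int[P]_(t in Q @^-1` A) \int[Kq (Q t)]_x f x)%E.
Proof.
move=> mA mf f0; set D := Q @^-1` A.
have mD : measurable D by rewrite -[X in measurable X]setTI; exact: mQ.
have mY : measurable_fun setT Y by [].
have mYB B : measurable B -> measurable (Y @^-1` B).
  by move=> mB; rewrite -[X in measurable X]setTI; exact: mY.
pose nu : {measure set T1 -> \bar R} := pushforward (mrestr P mD) Y.
(* The law of [Y] on the event [D] is a mixture in two ways: of the selective
   laws, and of the point masses at the values of [Y]. *)
rewrite -(@ge0_integral_mixture _ _ T T1 R P D mD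
  (fun t => Kq (Q t)) (nu mY))//.
- rewrite (@ge0_integral_mixture _ _ T T1 R P D mD
    (fun t => dirac (Y t)) (nu mY))//.
  + by apply: eq_integral => t _; rewrite integral_dirac// diracT mul1e.
  + move=> B mB; exact: (measurableT_comp (measurable_fun_dirac mB)).
  + move=> B mB; rewrite -[LHS]/(P (Y @^-1` B `&` D)).
    transitivity (\int[P]_(t in D) (\1_(Y @^-1` B) t)%:E)%E.
      by rewrite integral_indic//; exact: mYB.
    by apply: eq_integral => t _; rewrite /= /dirac !indicE.
- move=> B mB.
  by apply: (measurableT_comp (measurable_selective_prob mB)).
- by move=> B mB; rewrite -[LHS]/(P (Y @^-1` B `&` D)) setIC K_sel.
Qed.

End selective.

(** The event [F (Q t) < v] is the countable union of the events
[F (Q t) <= r k] with [r k] increasing to [v]; on each of them the hypothesis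
yields [v * p <= r k * p] for its probability [p], hence [p = 0]. *)
Lemma ae_lower_bound d d2 (T : measurableType d) (S : measurableType d2)
    (R : realType) (P : probability T R) (Q : T -> S) (F : S -> \bar R)
    (v : R) :
  measurable_fun setT Q -> measurable_fun setT F -> (forall q, 0 <= F q)%E ->
  (forall A, measurable A ->
    (v%:E * P (Q @^-1` A) <= \int[P]_(t in Q @^-1` A) F (Q t))%E) ->
  {ae P, forall t, (v%:E <= F (Q t))%E}.
Proof.
move=> mQ mF F0 H.
have [v0|v0] := leP v 0.
  apply: aeW => t; apply: le_trans (F0 _); by rewrite lee_fin.
pose r k : R := v - v / k.+1%:R.
have r0 k : 0 <= r k.
  by rewrite subr_ge0 ler_pdivrMr ?ltr0n// ler_peMr ?(ltW v0)// ler1n.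
have rv k : r k < v by rewrite ltrBlDr ltrDl divr_gt0// ltr0n.
pose A k := [set q | (F q <= (r k)%:E)%E].
have mA k : measurable (A k).
  by rewrite -[X in measurable X]setTI; exact: emeasurable_fun_infty_c.
have mQA k : measurable (Q @^-1` A k).
  by rewrite -[X in measurable X]setTI; exact: mQ.
have PA k : P (Q @^-1` A k) = 0%E.
  have := H _ (mA k).
  have : (\int[P]_(t in Q @^-1` A k) F (Q t) <= (r k)%:E * P (Q @^-1` A k))%E.
    rewrite -integral_cst//; apply: ge0_le_integral => //.
    - by apply: measurable_funTS; exact: (measurableT_comp mF).
  move=> /[swap] /le_trans /[apply].
  have Pfin : P (Q @^-1` A k) \is a fin_num by rewrite fin_num_measure.
  have P0 : 0 <= fine (P (Q @^-1` A k)) by exact: fine_ge0.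
  rewrite -(fineK Pfin) -!EFinM lee_fin => vr.
  congr EFin; apply/eqP; rewrite eq_le P0 andbT leNgt; apply/negP => p1.
  by move: vr; rewrite ler_pM2r// leNgt rv.
exists (\bigcup_k (Q @^-1` A k)); split.
- exact: bigcup_measurable.
- apply/eqP; rewrite eq_le measure_ge0 andbT.
  apply: (le_trans (measure_sigma_subadditive _ mQA _ _)) => //.
    exact: bigcup_measurable.
  by rewrite eseries0// => k _ _; exact: PA.
- move=> t /= /negP; rewrite -ltNge.
  have := F0 (Q t); case FQ : (F (Q t)) => [x| |]//.
  rewrite lee_fin lte_fin => x0 xv.
  have [k xk] : exists k, x <= r k.
    have /ltr_add_invr[k] : x / v < 1 by rewrite ltr_pdivrMr ?mul1r.
    move=> xk; exists k.
    rewrite /r lerBrDr -(ler_pM2r (_ : 0 < v^-1)) ?invr_gt0//.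
    by rewrite mulrDl mulrAC divff ?gt_eqF// mul1r ltW.
  by exists k => //; rewrite /A/= FQ lee_fin.
Qed.

(** * Quadratic forms and covariance matrices *)

Lemma ge0_rational_dense (R : realType) (I : finType) (f : (I -> R) -> R) :
  (forall (u : nat -> I -> R) (b : I -> R),
    (forall i, u n i @[n --> \oo] --> b i) -> f (u n) @[n --> \oo] --> f b) ->
  (forall q : {ffun I -> rat}, 0 <= f (fun i => ratr (q i))) ->
  forall b, 0 <= f b.
Proof.
move=> cf fq b.
have approx i n : exists q : rat, ratr q \in `](b i), (b i + n.+1%:R^-1)[.
  by apply: rat_in_itvoo; rewrite ltrDl invr_gt0 ltr0n.
have /choice[q qP] : forall p : I * nat, exists q : rat,
    ratr q \in `](b p.1), (b p.1 + p.2.+1%:R^-1)[.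
  by move=> p; exact: approx.
pose u n i : R := ratr (q (i, n)).
have cu i : u n i @[n --> \oo] --> b i.
  apply: (@squeeze_cvgr _ _ _ _ (fun=> b i) (fun n => b i + n.+1%:R^-1)).
  - apply: nearW => n; have := qP (i, n); rewrite in_itv/= => /andP[h1 h2].
    by rewrite (ltW h1) (ltW h2).
  - exact: cvg_cst.
  - rewrite -[X in _ --> X]addr0; apply: cvgD; first exact: cvg_cst.
    exact: cvg_harmonic.
have := cf _ _ cu => /cvg_lim <- //.
apply: limr_ge; first by apply/cvg_ex; exists (f b); exact: cf.
apply: nearW => n; have := fq [ffun i => q (i, n)].
by congr (0 <= f _); apply/funext => i; rewrite ffunE.
Qed.

Section square_integrable.
Context d (T : measurableType d) (R : realType) (mu : probability T R).

(** Measurability is included so that a single hypothesis passes to linear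
combinations. *)
Definition square_integrable (f : T -> R) :=
  measurable_fun setT f /\ (\int[mu]_x (f x ^+ 2)%:E < +oo)%E.

Let sqr_fun_measurable (f : T -> R) : measurable_fun setT f ->
  measurable_fun setT (fun x => (f x ^+ 2)%:E).
Proof. by move=> mf; apply/measurable_EFinP; exact: measurable_funX. Qed.

Lemma square_integrable_cst c : square_integrable (fun=> c).
Proof.
split; first exact: measurable_cst.
by rewrite integral_cst// (le_lt_trans _ (ltry (c ^+ 2)))// -[leRHS]mule1
  lee_wpmul2l ?lee_fin ?sqr_ge0// probability_le1.
Qed.

Lemma square_integrableZ c f :
  square_integrable f -> square_integrable (fun x => c * f x).
Proof.
move=> [mf foo]; split; first exact: measurable_funM.
under eq_integral do rewrite exprMn EFinM.
rewrite ge0_integralZl ?lee_fin ?sqr_ge0//; last 2 first.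
- exact: sqr_fun_measurable.
- by move=> x _; rewrite lee_fin sqr_ge0.
by rewrite lte_mul_pinfty// lee_fin sqr_ge0.
Qed.

Lemma square_integrableD f g : square_integrable f -> square_integrable g ->
  square_integrable (fun x => f x + g x).
Proof.
move=> [mf foo] [mg goo]; split; first exact: measurable_funD.
have mf2 := sqr_fun_measurable mf; have mg2 := sqr_fun_measurable mg.
have s0 (h : T -> R) x : setT x -> (0 <= (h x ^+ 2)%:E)%E.
  by rewrite lee_fin sqr_ge0.
apply: (@le_lt_trans _ _
  (2%:E * (\int[mu]_x (f x ^+ 2)%:E + \int[mu]_x (g x ^+ 2)%:E))%E); last first.
  by rewrite lte_mul_pinfty// lte_add_pinfty.
rewrite -ge0_integralD//; try exact: s0.
rewrite -ge0_integralZl//; last 2 first.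
- exact: emeasurable_funD.
- by move=> x _; rewrite adde_ge0// lee_fin sqr_ge0.
apply: ge0_le_integral => //; try exact: s0.
- by apply/sqr_fun_measurable; exact: measurable_funD.
- by apply: measurable_funeM; exact: emeasurable_funD.
- move=> x _; rewrite -EFinD -EFinM lee_fin -subr_ge0.
  by rewrite [leRHS](_ : _ = (f x - g x) ^+ 2) ?sqr_ge0//; ring.
Qed.

Lemma square_integrable_sum (I : Type) (r : seq I) (F : I -> T -> R) :
  (forall i, square_integrable (F i)) ->
  square_integrable (fun x => \sum_(i <- r) F i x).
Proof.
move=> sF; elim: r => [|i r IH].
  under eq_fun do rewrite big_nil; exact: square_integrable_cst.
by under eq_fun do rewrite big_cons; exact: square_integrableD.
Qed.

Lemma square_integrable_mul f g : square_integrable f -> square_integrable g ->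
  mu.-integrable setT (fun x => (f x * g x)%:E).
Proof.
move=> [mf foo] [mg goo]; apply/integrableP; split.
  by apply/measurable_EFinP; exact: measurable_funM.
have mf2 := sqr_fun_measurable mf; have mg2 := sqr_fun_measurable mg.
have s0 (h : T -> R) x : setT x -> (0 <= (h x ^+ 2)%:E)%E.
  by rewrite lee_fin sqr_ge0.
apply: (@le_lt_trans _ _
  (\int[mu]_x (f x ^+ 2)%:E + \int[mu]_x (g x ^+ 2)%:E)%E); last first.
  by rewrite lte_add_pinfty.
rewrite -ge0_integralD//; try exact: s0.
apply: ge0_le_integral => //.
- apply/measurableT_comp => //; apply/measurable_EFinP; exact: measurable_funM.
- exact: emeasurable_funD.
- move=> x _; rewrite -EFinD lee_fin normrM -(real_normK (num_real (f x))).
  rewrite -(real_normK (num_real (g x))).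
  set p := `|f x|; set q := `|g x|.
  have p0 : 0 <= p := normr_ge0 _.
  have q0 : 0 <= q := normr_ge0 _.
  by nra.
Qed.

Lemma integral_sqr_sum (I : finType) (w : I -> T -> R) (b : I -> R) :
  (forall i, square_integrable (w i)) ->
  (\int[mu]_x ((\sum_i b i * w i x) ^+ 2)%:E =
  (\sum_i \sum_j b i * b j * fine (\int[mu]_x (w i x * w j x)%:E))%:E)%E.
Proof.
move=> sw.
have iw i j : mu.-integrable setT (fun x => (w i x * w j x)%:E).
  exact: square_integrable_mul.
have iwb i j : mu.-integrable setT
    (fun x => (b i * b j)%:E * (w i x * w j x)%:E)%E.
  exact: integrableZl.
transitivity (\int[mu]_x \sum_i \sum_j ((b i * b j)%:E * (w i x * w j x)%:E))%E.
  apply: eq_integral => x _; rewrite expr2 big_distrlr/= -sumEFin.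
  apply: eq_bigr => i _; rewrite -sumEFin; apply: eq_bigr => j _.
  by rewrite -EFinM; congr EFin; ring.
rewrite integral_sum//; last by move=> i; exact: integrable_sum.
rewrite -sumEFin; apply: eq_bigr => i _.
rewrite integral_sum// -sumEFin; apply: eq_bigr => j _.
rewrite integralZl// [RHS]EFinM fineK//.
exact: integrable_fin_num.
Qed.

End square_integrable.

Lemma cvg_sum_seq (R : realType) (I : Type) (r : seq I) (u : I -> nat -> R)
    (l : I -> R) : (forall i, u i n @[n --> \oo] --> l i) ->
  \sum_(i <- r) u i n @[n --> \oo] --> \sum_(i <- r) l i.
Proof. by move=> ul; apply: cvg_big => //; exact: add_continuous. Qed.

(** Both sides are quadratic forms in the coefficients [(c, a)], hence
continuous in them. *)
Lemma quadratic_bound_dense d (T : measurableType d) (R : realType)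
    (mu : probability T R) (n : nat) (Z : 'I_n -> T -> R) (v : R) :
  (forall i, square_integrable mu (Z i)) ->
  (forall q : {ffun 'I_n.+1 -> rat},
    ((v * \sum_(i < n) ratr (q (lift ord0 i)) ^+ 2)%:E <=
     \int[mu]_x ((ratr (q ord0) +
        \sum_(i < n) ratr (q (lift ord0 i)) * Z i x) ^+ 2)%:E)%E) ->
  forall (a : 'I_n -> R) (c : R),
    ((v * \sum_(i < n) a i ^+ 2)%:E <=
     \int[mu]_x ((c + \sum_(i < n) a i * Z i x) ^+ 2)%:E)%E.
Proof.
move=> sZ bound a c.
(* The constant function has index [ord0] and [Z i] has index [lift ord0 i]. *)
pose w (j : 'I_n.+1) : T -> R := oapp Z (fun=> 1) (unlift ord0 j).
have sw j : square_integrable mu (w j).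
  by rewrite /w; case: unlift => //=; exact: square_integrable_cst.
pose G i j := fine (\int[mu]_x (w i x * w j x)%:E)%E.
pose f (b : 'I_n.+1 -> R) : R := \sum_i \sum_j b i * b j * G i j -
  v * \sum_(i < n) b (lift ord0 i) ^+ 2.
have fE (b : 'I_n.+1 -> R) : ((v * \sum_(i < n) b (lift ord0 i) ^+ 2)%:E <=
     \int[mu]_x ((b ord0 +
        \sum_(i < n) b (lift ord0 i) * Z i x) ^+ 2)%:E)%E = (0 <= f b).
  rewrite /f subr_ge0 -lee_fin -(integral_sqr_sum b sw); congr (_ <= _)%E.
  apply: eq_integral => x _; congr EFin; congr (_ ^+ 2).
  rewrite big_ord_recl /w unlift_none/= mulr1; congr (_ + _).
  by apply: eq_bigr => i _; rewrite liftK.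
pose b (j : 'I_n.+1) := oapp a c (unlift ord0 j).
have := fE b; rewrite {1 2 3}/b unlift_none/=.
under eq_bigr do rewrite /b liftK/=.
under [X in (_ <= X)%E]eq_integral do under eq_bigr do rewrite /b liftK/=.
move=> ->.
apply: (@ge0_rational_dense _ _ f); last by move=> q; rewrite -fE.
move=> u l ul; apply: cvgB.
  apply: cvg_sum_seq => i; apply: cvg_sum_seq => j; apply: cvgMl.
  by apply: cvgM; exact: ul.
apply: cvgMr; apply: cvg_sum_seq => i.
by apply: cvgM; exact: ul.
Qed.

(** The constant [c] is minus the mean of the linear combination, so that the
right-hand side is its variance. *)
Lemma covariance_mx_quadratic d (T : measurableType d) (R : realType)
    (mu : probability T R) (k : nat) (V : T -> 'cV[R]_k) (u : 'cV[R]_k) :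
  (forall i, square_integrable mu (fun x => V x i 0)) ->
  exists c, (((u^T *m covariance_mx mu V *m u) 0 0)%:E =
    \int[mu]_x ((c + \sum_i u i 0 * V x i 0) ^+ 2)%:E)%E.
Proof.
move=> sV; pose e i := fine ('E_mu[fun x => V x i 0]).
pose w i x := V x i 0 - e i.
have sw i : square_integrable mu (w i).
  by apply: square_integrableD => //; exact: square_integrable_cst.
exists (- \sum_i u i 0 * e i).
transitivity (\int[mu]_x ((\sum_i u i 0 * w i x) ^+ 2)%:E)%E; last first.
  apply: eq_integral => x _; congr EFin; congr (_ ^+ 2).
  by rewrite addrC -sumrB; apply: eq_bigr => i _; rewrite -mulrBr.
rewrite integral_sqr_sum//; congr EFin.
rewrite mxE; under eq_bigr do rewrite mxE big_distrl/=.
rewrite exchange_big/=; apply: eq_bigr => i _; apply: eq_bigr => j _.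
rewrite !mxE mulrAC; congr (_ * fine _).
by rewrite /w /e covariance.unlock expectation.unlock.
Qed.

Lemma covariance_mx_sym d (T : measurableType d) (R : realType)
    (mu : probability T R) (k : nat) (V : T -> 'cV[R]_k) :
  (covariance_mx mu V)^T = covariance_mx mu V.
Proof. by apply/matrixP => i j; rewrite !mxE covarianceC. Qed.

(** * The leftover Fisher information *)

Lemma ae_forall_countable d (T : measurableType d) (R : realType)
    (P : {measure set T -> \bar R}) (I : countType) (p : I -> T -> Prop) :
  (forall i, {ae P, forall t, p i t}) -> {ae P, forall t, forall i, p i t}.
Proof.
move=> pae.
have : {ae P, forall t, forall k : nat,
    if unpickle k is Some i then p i t else True}.
  apply: ae_foralln => k; case: unpickle => [i|]; first exact: pae.
  exact: aeW.
by apply: filterS => t /= h i; have := h (pickle i); rewrite pickleK.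
Qed.

Section leftover.
Context (R : realType) (n : nat) (sigma gamma : R)
  (sigma_gt0 : 0 < sigma) (gamma_gt0 : 0 < gamma)
  (dS : measure_display) (S : measurableType dS)
  (Qhat : {mfun 'cV[R]_n >-> S})
  (d : measure_display) (T : measurableType d) (P : probability T R)
  (y omega : {RV P >-> 'cV[R]_n})
  (omega_normal : isotropic_normal 0 gamma (distribution P omega))
  (y_omega_indep : independent_RV y omega)
  (K : {mfun S >-> pprobability 'cV[R]_n R})
  (K_selective :
    selective_distribution y (fun t => Qhat (y t + omega t)) K)
  (m : 'cV[R]_n) (y_normal : isotropic_normal m sigma (distribution P y)).

Let tau := sigma ^+ 2 / (sigma ^+ 2 + gamma ^+ 2).
Let s := sigma * gamma / Num.sqrt (sigma ^+ 2 + gamma ^+ 2).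
Let Q t := Qhat (y t + omega t).
Let Kq (q : S) : probability 'cV[R]_n R := K q.
Let Z (i : 'I_n) (x : 'cV[R]_n) : R := x i 0 - m i 0.

Let mZ i : measurable_fun setT (Z i).
Proof. by apply: measurable_funB => //; exact: measurable_coord. Qed.

Let msub : measurable_fun setT (fun x : 'cV[R]_n => x - m).
Proof.
apply: measurable_fun_cV => i; under eq_fun do rewrite !mxE.
exact: mZ.
Qed.

Let madd : measurable_fun setT (fun x : 'cV[R]_n => x + m).
Proof.
apply: measurable_fun_cV => i; under eq_fun do rewrite !mxE.
by apply: measurable_funD => //; exact: measurable_coord.
Qed.

Let mQ : measurable_fun setT Q.
Proof.
apply: (@measurableT_comp _ _ _ _ _ _ Qhat) => //.
apply: measurable_fun_cV => i; under eq_fun do rewrite !mxE.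
by apply: measurable_funD; apply: (measurableT_comp (measurable_coord i)).
Qed.

Let s_gt0 : 0 < s.
Proof. by rewrite divr_gt0 ?mulr_gt0// sqrtr_gt0 addr_gt0 ?exprn_gt0. Qed.

Let mquad (a : 'I_n -> R) (c : R) :
  measurable_fun setT (fun x : 'cV[R]_n => ((c + \sum_i a i * Z i x) ^+ 2)%:E).
Proof.
apply/measurable_EFinP/measurable_funX/measurable_funD => //.
by apply: measurable_sum => i; apply: measurable_funM.
Qed.

Let quad_ge0 (a : 'I_n -> R) (c : R) (x : 'cV[R]_n) :
  (0 <= ((c + \sum_i a i * Z i x) ^+ 2)%:E)%E.
Proof. by rewrite lee_fin sqr_ge0. Qed.

(** The constant [c] is deterministic here; the passage to the random center of
the selective law is made only once the null set no longer depends on [c]. *)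
Lemma ae_quadratic_bound (a : 'I_n -> R) (c : R) :
  {ae P, forall t, ((s ^+ 2 * \sum_i a i ^+ 2)%:E <=
    \int[Kq (Q t)]_x ((c + \sum_i a i * Z i x) ^+ 2)%:E)%E}.
Proof.
pose F q := (\int[Kq q]_x ((c + \sum_i a i * Z i x) ^+ 2)%:E)%E.
apply: (@ae_lower_bound _ _ T S R P Q F) => //.
- exact: measurable_int_selective.
- by move=> q; exact: integral_ge0.
move=> B mB; rewrite -(ge0_integral_selective mQ K_selective)//.
have [z zE z_normal] := isotropic_center (lt0r_neq0 sigma_gt0) y_normal.
have zw : independent_RV z omega.
  move=> A C mA mC.
  have -> : z @^-1` A = y @^-1` ((fun x => x - m) @^-1` A).
    by apply/seteqP; split => t /=; rewrite zE.
  apply: y_omega_indep => //; rewrite -[X in measurable X]setTI.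
  exact: msub.
have [U [e [UE zUe Ue e_normal]]] :=
  gaussian_decomposition sigma_gt0 gamma_gt0 z_normal omega_normal zw.
pose B' := (fun u : 'cV[R]_n => Qhat (u + m)) @^-1` B.
have mB' : measurable B'.
  rewrite -[X in measurable X]setTI.
  have mQm : measurable_fun setT (fun u : 'cV[R]_n => Qhat (u + m)).
    exact: (measurableT_comp _ madd).
  exact: (mQm measurableT B mB).
have QU : Q @^-1` B = U @^-1` B'.
  apply/seteqP; split => t; rewrite /preimage/= /Q /B'/= UE zE;
    by rewrite addrAC subrK.
pose g (u : 'cV[R]_n) := c + tau * \sum_i a i * u i 0.
have mg : measurable_fun setT g.
  apply: measurable_funD => //; apply: measurable_funM => //.
  apply: measurable_sum => i; apply: measurable_funM => //.
  exact: measurable_coord.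
rewrite QU.
apply: le_trans (integral_sqr_add_noise_ge a s_gt0 Ue e_normal mB' mg) _.
rewrite le_eqVlt; apply/orP; left; apply/eqP.
apply: eq_integral => t _; congr EFin; congr (_ ^+ 2).
rewrite /g -addrA; congr (_ + _); rewrite mulr_sumr -big_split/=.
apply: eq_bigr => i _.
have -> : Z i (y t) = z t i 0 by rewrite zE !mxE.
by rewrite zUe !mxE -/tau; ring.
Qed.

(** The second moments under the selective laws average to [sigma^2]. *)
Lemma ae_square_integrable (i : 'I_n) :
  {ae P, forall t, square_integrable (Kq (Q t)) (Z i)}.
Proof.
pose f (x : 'cV[R]_n) := (Z i x ^+ 2)%:E.
have mf : measurable_fun setT f.
  by apply/measurable_EFinP; exact: measurable_funX.
have f0 x : (0 <= f x)%E by rewrite lee_fin sqr_ge0.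
have [z zE z_normal] := isotropic_center (lt0r_neq0 sigma_gt0) y_normal.
have int_f : (\int[P]_t \int[Kq (Q t)]_x f x = (sigma ^+ 2)%:E)%E.
  have := ge0_integral_selective mQ K_selective measurableT mf f0.
  rewrite preimage_setT => <-.
  rewrite -(isotropic_coord_moment2 sigma_gt0 z_normal i).
  rewrite ge0_integral_distribution//; last 2 first.
  - by apply/measurable_EFinP/measurable_funX; exact: measurable_coord.
  - by move=> x; rewrite lee_fin sqr_ge0.
  by apply: eq_integral => t _; rewrite /f /Z /= zE !mxE.
have : P.-integrable setT (fun t => \int[Kq (Q t)]_x f x)%E.
  apply/integrableP; split.
    have mF : measurable_fun setT (fun q => \int[Kq q]_x f x)%E.
      exact: measurable_int_selective.
    exact: (measurableT_comp mF mQ).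
  under eq_integral do rewrite gee0_abs ?integral_ge0//.
  by rewrite int_f ltry.
move=> /(integrable_ae measurableT); apply: filterS => t /(_ I) fin.
split; first exact: mZ.
rewrite -ge0_fin_numE; first exact: fin.
by apply: integral_ge0 => x _; exact: f0.
Qed.

(** In the direction [u] the score is [a . (x - m)] with [a = sigma^-2 A u], and
[s^2 |a|^2] is the value at [u] of the quadratic form of the left-hand side
because [s^2 = (1 - tau) sigma^2]. *)
Lemma leftover_lower_bound (k : nat) (A : 'M[R]_(n, k)) :
  {ae P, forall t,
    loewner_le ((1 - tau) *: (sigma ^- 2 *: (A^T *m A)))
      (covariance_mx (Kq (Q t)) (fun x => sigma ^- 2 *: (A^T *m (x - m))))}.
Proof.
have sq : {ae P, forall t, forall i, square_integrable (Kq (Q t)) (Z i)}.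
  by apply: ae_forall_countable => i; exact: ae_square_integrable.
have bd : {ae P, forall t, forall q : {ffun 'I_n.+1 -> rat},
    ((s ^+ 2 * \sum_(i < n) ratr (q (lift ord0 i)) ^+ 2)%:E <=
     \int[Kq (Q t)]_x ((ratr (q ord0) +
        \sum_(i < n) ratr (q (lift ord0 i)) * Z i x) ^+ 2)%:E)%E}.
  apply: ae_forall_countable => q.
  exact: (ae_quadratic_bound (fun i => ratr (q (lift ord0 i))) (ratr (q ord0))).
apply: filterS2 sq bd => t sZ /(quadratic_bound_dense sZ) {}bd.
set mu := Kq (Q t); pose V x := sigma ^- 2 *: (A^T *m (x - m)).
have VE x j : V x j 0 = \sum_i sigma ^- 2 * A i j * Z i x.
  rewrite !mxE mulr_sumr; apply: eq_bigr => i _.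
  by rewrite !mxE mulrA.
have sV j : square_integrable mu (fun x => V x j 0).
  under eq_fun do rewrite VE.
  by apply: square_integrable_sum => i; exact: square_integrableZ.
split.
  rewrite linearB/= covariance_mx_sym !linearZ/= trmx_mul trmxK.
  by [].
move=> u; rewrite mulmxBr mulmxBl mxE [X in _ + X]mxE subr_ge0.
have [c cE] := covariance_mx_quadratic u sV.
rewrite -lee_fin cE.
pose a i := sigma ^- 2 * (A *m u) i 0.
apply: le_trans
  (_ : _ <= \int[mu]_x ((c + \sum_i a i * Z i x) ^+ 2)%:E)%E _; last first.
  rewrite le_eqVlt; apply/orP; left; apply/eqP; apply: eq_integral => x _.
  congr EFin; congr (_ ^+ 2); congr (_ + _).
  under [RHS]eq_bigr do rewrite VE mulr_sumr.
  rewrite exchange_big/=; apply: eq_bigr => i _.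
  rewrite /a mxE mulr_sumr mulr_suml; apply: eq_bigr => j _; ring.
apply: le_trans (bd a c); rewrite lee_fin le_eqVlt; apply/orP; left; apply/eqP.
rewrite -!scalemxAr -!scalemxAl.
have -> : (u^T *m (A^T *m A) *m u) = (A *m u)^T *m (A *m u).
  by rewrite trmx_mul !mulmxA.
rewrite !mxE !mulr_sumr; apply: eq_bigr => i _.
rewrite /a mxE /s /tau expr_div_n sqr_sqrtr; last first.
  by rewrite addr_ge0 ?sqr_ge0.
field.
by rewrite !gt_eqF ?addr_gt0 ?exprn_gt0.
Qed.

End leftover.
Theorem lemma5 (R : realType) (n p : nat) (X : 'M[R]_(n, p))
  (sigma gamma : R) (sigma_gt0 : 0 < sigma) (gamma_gt0 : 0 < gamma)
  (questions : Type) (G : set (set (set questions)))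
  (Qhat : {mfun 'cV[R]_n >-> g_sigma_algebraType G})
  (d : measure_display) (T : measurableType d) (P : probability T R)
  (y omega : {RV P >-> 'cV[R]_n})
  (omega_normal : isotropic_normal 0 gamma (distribution P omega))
  (y_omega_indep : independent_RV y omega)
  (K : {mfun g_sigma_algebraType G >-> pprobability 'cV[R]_n R})
  (K_selective :
    selective_distribution y (fun t => Qhat (y t + omega t)) K) :
  let tau := sigma ^+ 2 / (sigma ^+ 2 + gamma ^+ 2) in
  (forall mu : 'cV[R]_n,
     isotropic_normal mu sigma (distribution P y) ->
     {ae P, forall t,
       loewner_le ((1 - tau) *: fisher_sat n sigma)
         (leftover_fisher K (score_sat sigma mu) (Qhat (y t + omega t)))}) /\
  (forall (E : {set 'I_p}) (beta : 'cV[R]_#|E|),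
     isotropic_normal (submx_cols X E *m beta) sigma (distribution P y) ->
     {ae P, forall t,
       loewner_le ((1 - tau) *: fisher_sel X E sigma)
         (leftover_fisher K (score_sel X sigma beta)
            (Qhat (y t + omega t)))}).
Proof.
move=> tau; split => [mu mu_normal|E beta beta_normal].
  have := leftover_lower_bound sigma_gt0 gamma_gt0 omega_normal y_omega_indep
    K_selective mu_normal 1%:M.
  apply: filterS => t; rewrite trmx1 mulmx1 /leftover_fisher /fisher_sat.
  rewrite (_ : (fun x => _) = score_sat sigma mu)//.
  by apply/funext => x; rewrite mul1mx.
exact: (leftover_lower_bound sigma_gt0 gamma_gt0 omega_normal y_omega_indep
  K_selective beta_normal (submx_cols X E)).
Qed.
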